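(* Let $I\subset\mathbb{R}$ be a bounded interval and let $n$ be a positive integer. Then: (i) there are no polynomials $f$ of degree $1<\deg(f)<2n-1$ in the class $P_n(I)$; (ii) there exists a polynomial $f$ of any degree $\deg(f)\ge 2n-1$ in $P_n(I)$; (iii) any polynomial $f$ of degree $\deg(f)=2n-1$ or $\deg(f)=2n$ belonging to $P_n(I)$ lies in the gap, that is, $f\in P_n(I)\setminus P_{n+1}(I)$.
   Context: Intervals are non-trivial (more than one point). For a positive integer $n$ and an interval $I\subset\mathbb{R}$, $P_n(I)$ denotes the class of real-valued continuous functions $f:I\to\mathbb{R}$ that are matrix monotone of order $n$: for any two self-adjoint (complex Hermitian) $n\times n$ matrices $x,y$ with eigenvalues in $I$, $x\le y$ implies $f(x)\le f(y)$. Here $f(x)$ is defined by functional calculus and $x\le y$ means that $y-x$ is positive semidefinite. A polynomial (with real coefficients) is regarded as the function it defines on $I$.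
   Formalization: In (iii) the polynomial is additionally assumed to have degree greater than 1; this excludes only n = 1, deg(f) = 1, where the claim is false, since f(t) = t lies in every class P_k(I). *)

(* Defs.v *)
From mathcomp Require Import all_boot all_order all_algebra.
From mathcomp Require Import complex.
From mathcomp Require Import all_classical all_reals all_analysis.

Set Implicit Arguments.
Unset Strict Implicit.
Unset Printing Implicit Defensive.

Import Order.TTheory GRing.Theory Num.Theory.
Import numFieldNormedType.Exports.

Local Open Scope classical_set_scope.
Local Open Scope complex_scope.
Local Open Scope sesquilinear_scope.
Local Open Scope ring_scope.

Definition nontrivial_interval (R : realType) (I : set R) : Prop :=
  is_interval I /\ exists a b : R, [/\ I a, I b & a != b].

Definition spectrum_in (R : realType) (I : set R) n (x : 'M[R[i]]_n) : Prop :=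
  forall z : R[i], eigenvalue x z -> exists2 t : R, I t & z = t%:C.

(* [v] is a row vector, so with u := v^t* the form below is u^* a u; on R[i],
   [0 <= z] means that z is real and nonnegative. *)
Definition psdmx (R : realType) n (a : 'M[R[i]]_n) : Prop :=
  a \is hermsymmx /\ forall v : 'rV[R[i]]_n, 0 <= (v *m a *m v^t*) 0 0.

Definition loewner_le (R : realType) n (x y : 'M[R[i]]_n) : Prop :=
  psdmx (y - x).

(* Functional calculus. A Hermitian [x] satisfies
   x = invmx (spectralmx x) *m diag_mx (spectral_diag x) *m spectralmx x
   with [spectralmx x] unitary and [spectral_diag x] real, so f is applied to
   the eigenvalues of [x] only. The result does not depend on the chosen
   diagonalisation. *)
Definition mxfun (R : realType) n (f : R -> R) (x : 'M[R[i]]_n) : 'M[R[i]]_n :=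
  invmx (spectralmx x)
    *m diag_mx (map_mx (fun z : R[i] => (f (complex.Re z))%:C) (spectral_diag x))
    *m spectralmx x.

(* The class P_n(I). A function on I is represented by a total function; only
   its values on I matter. *)
Definition matrix_monotone (R : realType) (n : nat) (I : set R) (f : R -> R)
    : Prop :=
  {within I, continuous f} /\
  forall x y : 'M[R[i]]_n,
    x \is hermsymmx -> y \is hermsymmx ->
    spectrum_in I x -> spectrum_in I y ->
    loewner_le x y -> loewner_le (mxfun f x) (mxfun f y).

(* The zero polynomial gets degree 0. *)
Definition degree (R : realType) (p : {poly R}) : nat := (size p).-1.

(* Main.v *)
Require Import Defs.
From mathcomp Require Import all_boot all_order all_algebra.
From mathcomp Require Import complex.
From mathcomp Require Import all_classical all_reals all_analysis.
From mathcomp Require Import ring zify lra.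

(** Low degrees.  Up to an affine change of variable that preserves the degree
    and moves the spectra into I, compare p at the adjacency matrix A of a path
    0 - 1 - ... - (n-1) and at A + E, where E puts a loop on vertex 0; then
    A <= A + E.  The entry (i, j) of (A + E)^m - A^m counts the walks of length
    m from i to j that use the loop: there are none for m <= i + j and exactly
    one for m = i + j + 1.  So the entry (i, j) of p(A + E) - p(A) is the
    coefficient of degree i + j + 1 of p as soon as deg p <= i + j + 1
    ([horner_loop_walk]).  When 1 < deg p < 2n - 1 one can choose vertices k
    and j with deg p <= 2k and j + k + 1 = deg p: the diagonal entry at k
    vanishes while the entry (j, k) is the leading coefficient, which is
    impossible in a positive semidefinite matrix ([psd_zero_diag]).  The gap
    statement is this result for n + 1, because 2n < 2(n + 1) - 1.

    Existence.  Let c_m be the m-th moment of the counting measure on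
    {1, ..., n}, and f = c_0 X + c_1 X^2 + ... + c_(d-1) X^d.  For x <= y write
    y - x = b^* b, and for a row vector w put u_i = w x^i b^* and
    v_j = w y^j b^*.  The noncommutative telescoping of y^m - x^m gives
    [moment_poly_form]:

      w (f(y) - f(x)) w^* = sum over i + j < d of c_(i+j) <u_i, v_j>.

    Since d >= 2n - 1 this sum contains all pairs i, j < n, and there the
    Hankel form with u_j in place of v_j is a sum of squares, coercive because
    a Vandermonde matrix is invertible ([hankel_coercive]).  If the spectra of
    x and y are small, everything else is a small multiple of the square of
    S = sum of the sizes of u_0, ..., u_(n-1): v_j - u_j carries a factor
    b y^a b^*, which is small with y - x, and u_i for i >= n is a combination
    of u_0, ..., u_(n-1) with small coefficients because x is annihilated by
    a monic polynomial of degree n with small roots ([small_recurrence]).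
    Hence f is monotone of order n on a neighbourhood of 0
    ([moment_poly_local_monotone]), and since I is bounded, f(s t) is monotone
    of order n on I for some s > 0. *)

Set Implicit Arguments.
Unset Strict Implicit.
Unset Printing Implicit Defensive.
Import Order.TTheory GRing.Theory Num.Theory.
Import numFieldNormedType.Exports.

Local Open Scope classical_set_scope.
Local Open Scope complex_scope.
Local Open Scope sesquilinear_scope.
Local Open Scope ring_scope.

(** * The entrywise l1 norm of a matrix *)

Section L1Norm.
Variable C : numClosedFieldType.

Definition l1norm m n (A : 'M[C]_(m, n)) : C := \sum_i \sum_j `|A i j|.

Lemma l1norm_ge0 m n (A : 'M[C]_(m, n)) : 0 <= l1norm A.
Proof. by apply: sumr_ge0 => i _; apply: sumr_ge0 => j _; apply: normr_ge0. Qed.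

Lemma ler_sum_term (I : finType) (F : I -> C) i :
  (forall j, 0 <= F j) -> F i <= \sum_j F j.
Proof. by move=> F0; rewrite (bigD1 i) //= lerDl sumr_ge0. Qed.

Lemma entry_le_l1norm m n (A : 'M[C]_(m, n)) i j : `|A i j| <= l1norm A.
Proof.
apply: (le_trans (ler_sum_term (F := fun j => `|A i j|) j _)) => //.
apply: (ler_sum_term (F := fun i => \sum_j `|A i j|)) => k.
by apply: sumr_ge0.
Qed.

Lemma l1normD m n (A B : 'M[C]_(m, n)) : l1norm (A + B) <= l1norm A + l1norm B.
Proof.
rewrite /l1norm -big_split; apply: ler_sum => i _ /=.
by rewrite -big_split; apply: ler_sum => j _; rewrite !mxE ler_normD.
Qed.

Lemma l1norm0 m n : l1norm (0 : 'M[C]_(m, n)) = 0.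
Proof. by rewrite /l1norm big1 // => i _; rewrite big1 // => j _; rewrite mxE normr0. Qed.

Lemma l1norm_sum (I : Type) (r : seq I) (P : pred I) m n (F : I -> 'M[C]_(m, n)) :
  l1norm (\sum_(i <- r | P i) F i) <= \sum_(i <- r | P i) l1norm (F i).
Proof.
elim/big_rec2: _ => [|i x y _ le_yx]; first by rewrite l1norm0.
by apply: le_trans (l1normD _ _) _; rewrite lerD2l.
Qed.

Lemma l1normZ m n a (A : 'M[C]_(m, n)) : l1norm (a *: A) = `|a| * l1norm A.
Proof.
rewrite /l1norm mulr_sumr; apply: eq_bigr => i _.
by rewrite mulr_sumr; apply: eq_bigr => j _; rewrite !mxE normrM.
Qed.

Lemma l1normB m n (A B : 'M[C]_(m, n)) : l1norm (A - B) <= l1norm A + l1norm B.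
Proof.
by apply: le_trans (l1normD _ _) _; rewrite -scaleN1r l1normZ normrN1 mul1r.
Qed.

Lemma l1normM m n p (A : 'M[C]_(m, n)) (B : 'M[C]_(n, p)) :
  l1norm (A *m B) <= l1norm A * l1norm B.
Proof.
have rowB k : \sum_j `|B k j| <= l1norm B.
  apply: (ler_sum_term (F := fun i => \sum_j `|B i j|)) => i.
  by apply: sumr_ge0.
rewrite {1 2}/l1norm mulr_suml; apply: ler_sum => i _.
apply: (@le_trans _ _ (\sum_j \sum_k `|A i k| * `|B k j|)).
  apply: ler_sum => j _; rewrite mxE; apply: le_trans (ler_norm_sum _ _ _) _.
  by apply: ler_sum => k _; rewrite normrM.
rewrite exchange_big mulr_suml; apply: ler_sum => k _ /=.
by rewrite -mulr_sumr ler_wpM2l.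
Qed.

(** The bound is the norm of the identity matrix, reached at k = 0. *)
Lemma mxpow_l1norm n (A : 'M[C]_n.+1) k :
  l1norm A <= 1 -> l1norm (A ^+ k) <= n.+1%:R.
Proof.
move=> A1; elim: k => [|k IH].
  rewrite expr0 /l1norm; under eq_bigr => i _.
    rewrite (bigD1 i) //= mxE eqxx normr1 big1 ?addr0.
      over.
    by move=> j /negPf ne; rewrite mxE eq_sym ne normr0.
  by rewrite sumr_const card_ord.
rewrite exprS; apply: le_trans (l1normM _ _) _; rewrite -[leRHS]mul1r.
by apply: ler_pM => //; apply: l1norm_ge0.
Qed.

(** Twice the difference is the sum over i and j of the squares of F i - F j. *)
Lemma sqr_sum_le (I : finType) (F : I -> C) : (forall i, 0 <= F i) ->
  (\sum_i F i) ^+ 2 <= #|I|%:R * \sum_i F i ^+ 2.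
Proof.
move=> F0; rewrite -(ler_pM2l (ltr0Sn C 1)) expr2 big_distrlr /=.
have -> : 2 * (#|I|%:R * \sum_i F i ^+ 2) = \sum_i \sum_j (F i ^+ 2 + F j ^+ 2).
  have rowE i : \sum_j (F i ^+ 2 + F j ^+ 2)
      = #|I|%:R * F i ^+ 2 + \sum_j F j ^+ 2.
    by rewrite big_split /= sumr_const mulr_natl.
  under [RHS]eq_bigr do rewrite rowE.
  by rewrite big_split /= -mulr_sumr sumr_const -[X in _ = _ + X]mulr_natl mulrDl mul1r.
rewrite mulr_sumr; apply: ler_sum => i _; rewrite mulr_sumr; apply: ler_sum => j _.
rewrite -subr_ge0 (_ : _ - _ = (F i - F j) ^+ 2).
  by rewrite real_exprn_even_ge0 // rpredB ?ger0_real.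
by rewrite sqrrB mulr_natl addrAC.
Qed.

Lemma l1norm_sqr_le m n (A : 'M[C]_(m, n)) :
  l1norm A ^+ 2 <= (m * n)%:R * \sum_i \sum_j `|A i j| ^+ 2.
Proof.
rewrite /l1norm !pair_bigA /=.
apply: le_trans (sqr_sum_le _) _; first by move=> p; apply: normr_ge0.
by rewrite card_prod !card_ord.
Qed.

(** The l1 norm is submultiplicative; apply it to an eigenvector. *)
Lemma eigenvalue_le_l1norm n (x : 'M[C]_n) z :
  eigenvalue x z -> `|z| <= l1norm x.
Proof.
move=> /eigenvalueP[v vx v0].
have v0' : 0 < l1norm v.
  have [k vk] : exists k, v 0 k != 0 by apply/rV0Pn.
  by apply: lt_le_trans (entry_le_l1norm v 0 k); rewrite normr_gt0.
by rewrite -(ler_pM2r v0') -l1normZ -vx mulrC l1normM.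
Qed.

End L1Norm.

(** * Hermitian matrices and their spectra *)

Section Hermitian.
Variable C : numClosedFieldType.

Lemma l1norm_adj m n (A : 'M[C]_(m, n)) : l1norm (A^t*) = l1norm A.
Proof.
rewrite /l1norm exchange_big; apply: eq_bigr => i _; apply: eq_bigr => j _.
by rewrite !mxE norm_conjC.
Qed.

Lemma row_sqnorm m (u : 'rV[C]_m) : (u *m u^t*) 0 0 = \sum_j `|u 0 j| ^+ 2.
Proof. by rewrite !mxE; apply: eq_bigr => j _; rewrite !mxE normCK. Qed.

Lemma inner_le p (u v : 'rV[C]_p) : `|(u *m v^t*) 0 0| <= l1norm u * l1norm v.
Proof.
apply: le_trans (entry_le_l1norm _ _ _) _; apply: le_trans (l1normM _ _) _.
by rewrite l1norm_adj.
Qed.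

Lemma hermsymmxE n (x : 'M[C]_n) : (x \is hermsymmx) = (x^t* == x).
Proof. by rewrite is_hermitianmxE expr0 scale1r eq_sym. Qed.

Lemma adjM m n p (x : 'M[C]_(m, n)) (y : 'M[C]_(n, p)) : (x *m y)^t* = y^t* *m x^t*.
Proof. by rewrite trmx_mul map_mxM. Qed.

Lemma hermX n (x : 'M[C]_n.+1) k : x^t* = x -> (x ^+ k)^t* = x ^+ k.
Proof.
move=> hx; elim: k => [|k IH]; first by rewrite expr0 trmx1 map_mx1.
by rewrite {1}exprS adjM IH hx exprSr.
Qed.

Lemma horner_herm n (x : 'M[C]_n.+1) p : p \is a polyOver Num.real ->
  x^t* = x -> (horner_mx x p)^t* = horner_mx x p.
Proof.
move=> /polyOverP pR hx; rewrite -[p]coefK poly_def rmorph_sum /=.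
rewrite linear_sum /= [LHS]raddf_sum; apply: eq_bigr => i _ /=.
rewrite linearZ /= rmorphXn /= horner_mx_X -[in RHS](hermX i hx).
by apply/matrixP => k l; rewrite !mxE rmorphM /= conj_Creal.
Qed.

Lemma hermitian_eigenvalue_real n (x : 'M[C]_n) z :
  x^t* = x -> eigenvalue x z -> z \is Num.real.
Proof.
move=> hx /eigenvalueP[v vx v0].
have vv : 0 < (v *m v^t*) 0 0.
  have [k vk] : exists k, v 0 k != 0 by apply/rV0Pn.
  rewrite row_sqnorm (bigD1 k) //= ltr_pwDl ?exprn_gt0 ?normr_gt0 //.
  by apply: sumr_ge0 => i _; rewrite exprn_ge0.
have : ((v *m x *m v^t*)^t*) = v *m x *m v^t* by rewrite !adjM trmxCK hx mulmxA.
rewrite vx -scalemxAl => /matrixP/(_ 0 0); rewrite [LHS]mxE [X in X^*]mxE [X in X^*]mxE.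
rewrite [RHS]mxE rmorphM /= (conj_Creal (gtr0_real vv)) => /(mulIf (lt0r_neq0 vv)) /eqP.
by rewrite CrealE.
Qed.

Definition spectrum_le n (x : 'M[C]_n) (e : C) :=
  forall z, eigenvalue x z -> `|z| <= e.

Lemma hermitian_spectralE n (x : 'M[C]_n) : x \is hermsymmx ->
  x = (spectralmx x)^t* *m diag_mx (spectral_diag x) *m spectralmx x.
Proof.
move=> /hermitian_normalmx /orthomx_spectralP {1}->.
by rewrite invmx_unitary ?spectral_unitarymx.
Qed.

Lemma eigenvalue_spectral_diag n (x : 'M[C]_n) i : x \is hermsymmx ->
  eigenvalue x (spectral_diag x 0 i).
Proof.
move=> hx; apply/eigenvalueP; exists (row i (spectralmx x)).
  rewrite {2}(hermitian_spectralE hx) -!row_mul !mulmxA.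
  rewrite (unitarymxP (spectral_unitarymx x)) mul1mx.
  by apply/rowP => j; rewrite mul_diag_mx !mxE.
apply: contraTneq (spectral_unitarymx x) => r0.
apply/negP => /unitarymxP /(congr1 (fun A => row i A)).
rewrite row_mul r0 mul0mx => /rowP /(_ i); rewrite !mxE eqxx => /eqP.
by rewrite eq_sym oner_eq0.
Qed.

Lemma horner_mx_spectral n (x : 'M[C]_n.+1) p : x \is hermsymmx ->
  horner_mx x p = (spectralmx x)^t*
    *m diag_mx (map_mx (horner p) (spectral_diag x)) *m spectralmx x.
Proof.
move=> /hermitian_normalmx /orthomx_spectralP {1}->.
by rewrite horner_mx_uconjC ?spectral_unit // horner_mx_diag
  invmx_unitary ?spectral_unitarymx.
Qed.

Lemma unitary_l1norm n (U : 'M[C]_n) : U \is unitarymx -> l1norm U <= (n * n)%:R.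
Proof.
move=> /unitarymxP UU; rewrite /l1norm.
have entry i j : `|U i j| <= 1.
  rewrite -(@expr_le1 _ 2) //.
  have /matrixP/(_ i i) := UU; rewrite !mxE eqxx mulr1n => <-.
  under eq_bigr do rewrite !mxE -normCK.
  by apply: (ler_sum_term (F := fun j => `|U i j| ^+ 2)) => k; rewrite exprn_ge0.
apply: (@le_trans _ _ (\sum_(i < n) \sum_(j < n) (1 : C))).
  by apply: ler_sum => i _; apply: ler_sum => j _.
by rewrite !sumr_const !card_ord -mulrnA.
Qed.

Lemma diag_l1norm n (D : 'rV[C]_n) e :
  (forall i, `|D 0 i| <= e) -> l1norm (diag_mx D) <= n%:R * e.
Proof.
move=> De; rewrite /l1norm.
apply: (@le_trans _ _ (\sum_(i < n) e)); last first.
  by rewrite sumr_const card_ord mulr_natl.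
apply: ler_sum => i _; rewrite (bigD1 i) //= big1 => [|j /negPf ne].
  by rewrite mxE eqxx mulr1n addr0.
by rewrite mxE eq_sym ne mulr0n normr0.
Qed.

(** The l1 norm is not unitarily invariant, so conjugating the diagonal form
    by a unitary matrix costs a power of the dimension; only the linearity in e
    matters later. *)
Lemma spectrum_l1norm n (x : 'M[C]_n) e : x \is hermsymmx ->
  spectrum_le x e -> l1norm x <= (n ^ 5)%:R * e.
Proof.
move=> hx xe; rewrite (hermitian_spectralE hx).
have U1 := unitary_l1norm (spectral_unitarymx x).
have D1 := diag_l1norm (fun i => xe _ (eigenvalue_spectral_diag i hx)).
apply: le_trans (l1normM _ _) _.
have -> : (n ^ 5)%:R * e = (n * n)%:R * (n%:R * e) * (n * n)%:R.
  by rewrite natrX natrM; ring.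
apply: ler_pM => //; try exact: l1norm_ge0.
apply: le_trans (l1normM _ _) _.
by apply: ler_pM => //; try exact: l1norm_ge0; rewrite l1norm_adj.
Qed.

(** The factor is the diagonal of square roots of the eigenvalues times the
    diagonalising unitary matrix. Its squared Hilbert-Schmidt norm is the trace
    of h, whence the bound. *)
Lemma psd_factor n (h : 'M[C]_n) : h \is hermsymmx ->
  (forall v : 'rV[C]_n, 0 <= (v *m h *m v^t*) 0 0) ->
  exists2 b : 'M[C]_n, h = b^t* *m b & l1norm b ^+ 2 <= (n * n)%:R * l1norm h.
Proof.
move=> hh h0; set d := spectral_diag h; set U := spectralmx h.
have hE : h = U^t* *m diag_mx d *m U := hermitian_spectralE hh.
have UU : U *m U^t* = 1%:M by apply/unitarymxP/spectral_unitarymx.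
have d0 i : 0 <= d 0 i.
  have dE : U *m h *m U^t* = diag_mx d.
    by rewrite hE !mulmxA UU mul1mx -mulmxA UU mulmx1.
  have := h0 (row i U); rewrite -row_mul.
  have -> : (row i (U *m h) *m (row i U)^t*) 0 0 = (U *m h *m U^t*) i i.
    by rewrite [in RHS]mxE mxE; apply: eq_bigr => k _; rewrite !mxE.
  by rewrite dE mxE eqxx mulr1n.
pose s := map_mx sqrtC d.
have sE : (diag_mx s)^t* *m diag_mx s = diag_mx d.
  apply/matrixP => i j; rewrite mul_mx_diag !mxE.
  have [->|ne] := eqVneq i j; last by rewrite !mulr0n conjC0 mul0r.
  by rewrite !mulr1n geC0_conj ?sqrtC_ge0 // -expr2 sqrtCK.
exists (diag_mx s *m U).
  by rewrite hE -sE trmx_mul map_mxM !mulmxA.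
set b := _ *m U.
have hb : h = b^t* *m b by rewrite hE -sE /b trmx_mul map_mxM !mulmxA.
apply: le_trans (l1norm_sqr_le _) _; apply: ler_wpM2l => //.
rewrite exchange_big /= /l1norm; apply: ler_sum => j _.
have hjj : \sum_i `|b i j| ^+ 2 = h j j.
  by rewrite hb !mxE; apply: eq_bigr => i _; rewrite !mxE normCKC.
have hjj0 : 0 <= h j j by rewrite -hjj sumr_ge0 // => i _; rewrite exprn_ge0.
rewrite hjj -[leLHS]ger0_norm //.
exact: (ler_sum_term (F := fun k => `|h j k|)).
Qed.

(** A form that vanishes on the k-th basis vector but has g = a j k <> 0 takes
    the value a j j - 2 t |g|^2 on e_j - t g e_k, which is negative for large t. *)
Lemma psd_zero_diag n (a : 'M[C]_n) (j k : 'I_n) : a^t* = a ->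
  (forall v : 'rV[C]_n, 0 <= (v *m a *m v^t*) 0 0) -> a k k = 0 -> a j k = 0.
Proof.
move=> ha psd akk; set g := a j k; apply/eqP; apply: contraT => g0.
have akj : a k j = g^* by rewrite -[in LHS]ha !mxE.
have n0 : 0 < `|g| ^+ 2 by rewrite exprn_gt0 // normr_gt0.
have fd l i : ((delta_mx 0 l : 'rV[C]_n) *m a *m (delta_mx 0 i : 'rV[C]_n)^t*) 0 0 = a l i.
  rewrite -rowE mxE (bigD1 i) //= !mxE !eqxx conjC1 mulr1 big1 ?addr0 //.
  by move=> m /negPf mi; rewrite !mxE mi andbF conjC0 mulr0.
have key t : t \is Num.real -> 0 <= a j j - 2 * t * `|g| ^+ 2.
  move=> tr; have := psd (delta_mx 0 j - (t * g) *: delta_mx 0 k).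
  rewrite (_ : (_ *m _) 0 0 = a j j - 2 * t * `|g| ^+ 2) //.
  have adj : (delta_mx 0 j - (t * g) *: delta_mx 0 k : 'rV[C]_n)^t*
     = (delta_mx 0 j)^t* - (t * g^*) *: (delta_mx 0 k)^t*.
    by apply/matrixP => p q; rewrite !mxE rmorphB !rmorphM /= (conj_Creal tr).
  have B00 (A B : 'M[C]_1) : (A - B) 0 0 = A 0 0 - B 0 0 by rewrite !mxE.
  have Z00 c (A : 'M[C]_1) : (c *: A) 0 0 = c * A 0 0 by rewrite mxE.
  rewrite adj !(mulmxBl, mulmxBr) -!(scalemxAl, scalemxAr) !(B00, Z00) !fd.
  by rewrite akk akj -/g normCK; ring.
have ajj : a j j \is Num.real.
  by have := key 0 (rpred0 _); rewrite mulr0 mul0r subr0 => /ger0_real.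
have tr : (a j j + 1) / (2 * `|g| ^+ 2) \is Num.real.
  by rewrite realM ?realV ?realD ?real1 // gtr0_real // mulr_gt0.
have := key _ tr.
rewrite (_ : _ - _ = -1) ?oppr_ge0 ?ler10 //.
by field; rewrite normr_eq0 g0.
Qed.

End Hermitian.

(** * Powers of a Hermitian matrix with small spectrum *)

Section SmallSpectrum.
Variable C : numClosedFieldType.

(** Each non-leading coefficient is a signed sum of products of at least one root. *)
Lemma prod_small_roots_coef n (r : 'I_n -> C) e : 0 <= e -> e <= 1 ->
  (forall i, `|r i| <= e) -> forall k, (k < n)%N ->
  `|(\prod_(i < n) ('X - (r i)%:P))`_k| <= (2 ^ n)%:R * e.
Proof.
move=> e0 e1.
(* The crude bound on all coefficients, leading one included, is what the new
   root multiplies in the induction step. *)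
suff H m : forall r : 'I_m -> C, (forall i, `|r i| <= e) ->
    let p := \prod_(i < m) ('X - (r i)%:P) in
    (forall k, (k < m)%N -> `|p`_k| <= (2 ^ m)%:R * e) /\
    (forall k, `|p`_k| <= (2 ^ m)%:R).
  by move=> re k km; have [h _] := H n r re; apply: h.
elim: m => [|m IH] {}r re p.
  split=> // k; rewrite /p big_ord0 coef1.
  by case: (k == 0%N); rewrite /= ?normr1 ?normr0.
have pE : p = (\prod_(i < m) ('X - (r (lift ord0 i))%:P)) * ('X - (r ord0)%:P).
  by rewrite /p big_ord_recl mulrC.
have [] := IH _ (fun i => re (lift ord0 i)).
set q := \prod_(i < m) _ in pE *; move=> q1 q2.
have coefp k : p`_k = (if k == 0%N then 0 else q`_k.-1) - q`_k * r ord0.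
  by rewrite pE mulrBr coefB coefMX coefMC.
have two : (2 ^ m.+1)%:R = (2 ^ m)%:R + (2 ^ m)%:R :> C.
  by rewrite expnS mul2n -addnn natrD.
have b0 : 0 <= (2 ^ m)%:R :> C by [].
split=> [k km|k]; rewrite coefp two ?mulrDl; apply: le_trans (ler_normB _ _) _; apply: lerD.
- case: k km => [|k] km /=; first by rewrite normr0 mulr_ge0.
  exact: q1.
- by rewrite normrM; apply: ler_pM.
- by case: ifP => _; rewrite ?normr0.
- rewrite normrM -[leRHS]mulr1; apply: ler_pM => //.
  exact: le_trans e1.
Qed.

(** The recurrence comes from the product of the X - d over the eigenvalues d,
    which annihilates x. *)
Lemma small_recurrence n (x : 'M[C]_n.+1) e : x \is hermsymmx -> 0 <= e -> e <= 1 ->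
  spectrum_le x e ->
  exists2 a : 'I_n.+1 -> C, forall k, `|a k| <= (2 ^ n.+1)%:R * e &
    x ^+ n.+1 = \sum_k a k *: x ^+ k.
Proof.
move=> hx e0 e1 xe; set d := spectral_diag x.
pose p := \prod_i ('X - (d 0 i)%:P).
have de i : `|d 0 i| <= e by apply: xe; apply: eigenvalue_spectral_diag.
have px0 : horner_mx x p = 0.
  rewrite horner_mx_spectral // (_ : map_mx (horner p) _ = 0).
    by rewrite linear0 mulmx0 mul0mx.
  apply/rowP => i; rewrite !mxE horner_prod (bigD1 i) //= hornerXsubC.
  by rewrite subrr mul0r.
have sp : size p = n.+2 by rewrite size_prod_XsubC /index_enum -enumT size_enum_ord.
have mp : p`_n.+1 = 1.
  have /monicP : p \is monic by apply: monic_prod_XsubC.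
  by rewrite lead_coefE sp.
exists (fun k => - p`_k) => [k|].
  by rewrite normrN; apply: prod_small_roots_coef.
move: px0; rewrite -{1}[p]coefK sp poly_def rmorph_sum /= big_ord_recr /= mp scale1r.
rewrite rmorphXn /= horner_mx_X => /eqP; rewrite addrC addr_eq0 => /eqP ->.
rewrite -sumrN; apply: eq_bigr => k _.
by rewrite linearZ /= rmorphXn /= horner_mx_X scaleNr.
Qed.

(** The conclusion a i <= S propagates through the recurrence because
    n * eta <= 1; one more application of the recurrence gains the factor eta. *)
Lemma recurrence_tail_le (a : nat -> C) n eta : (forall i, 0 <= a i) ->
  0 <= eta -> n%:R * eta <= 1 ->
  (forall i, a (i + n)%N <= \sum_(k < n) eta * a (i + k)%N) ->
  let S := \sum_(k < n) a k in
  forall i, a i <= S /\ ((n <= i)%N -> a i <= n%:R * eta * S).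
Proof.
move=> a0 eta0 neta rec S.
have S0 : 0 <= S by apply: sumr_ge0.
have step i : (forall k, (k < i + n)%N -> a k <= S) ->
    a (i + n)%N <= n%:R * eta * S.
  move=> IH; apply: le_trans (rec i) _.
  rewrite -mulrA [leRHS]mulr_natl -[X in _ *+ X]card_ord -sumr_const.
  by apply: ler_sum => k _; apply: ler_wpM2l => //; apply: IH; rewrite ltn_add2l.
have aS i : a i <= S.
  have [m] := ubnP i; elim: m i => // m IH i im.
  have [lt_in|le_ni] := ltnP i n.
    exact: (ler_sum_term (F := fun k : 'I_n => a k) (Ordinal lt_in)).
  rewrite -(subnK le_ni); apply: le_trans (step _ _) _.
    by move=> k; rewrite subnK // => ki; apply: IH; apply: leq_trans ki _.
  by rewrite -[leRHS]mul1r ler_wpM2r.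
move=> i; split=> // le_ni; rewrite -(subnK le_ni); apply: step => k _; exact: aS.
Qed.

End SmallSpectrum.

(** * Hankel forms of moments *)

(** The nodes 1, ..., n are distinct, for the Vandermonde matrix, and positive,
    so that no moment vanishes and the polynomial below has the full degree d. *)
Definition moment (n m : nat) : nat := (\sum_(l < n) l.+1 ^ m)%N.

(** The shift by one degree makes the word x^i (y - x) y^j appear with the
    coefficient [moment n (i + j)] in the difference of the values at y and x. *)
Definition moment_poly (R : nzRingType) (n d : nat) : {poly R} :=
  (\poly_(m < d) (moment n m)%:R) * 'X.

Section Hankel.
Variable C : numClosedFieldType.

(** With V the Vandermonde matrix of the nodes 1, ..., n, the form M is the
    sum of the |P l k|^2 for P = V U, where U has rows u_0, ..., u_(n-1); and U
    is recovered from P by applying the inverse of V. *)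
Lemma hankel_coercive n p : exists2 L : C, 0 <= L & forall u : nat -> 'rV[C]_p,
  let M := \sum_(i < n) \sum_(j < n)
    (moment n (i + j))%:R * (u i *m (u j)^t*) 0 0 in
  0 <= M /\ (\sum_(i < n) l1norm (u i)) ^+ 2 <= L * M.
Proof.
pose V : 'M[C]_n := (Vandermonde n (\row_l (l.+1)%:R))^T.
have Vunit : V \in unitmx.
  rewrite unitmxE det_tr det_Vandermonde unitfE; apply/prodf_neq0 => i _.
  apply/prodf_neq0 => j ij; rewrite !mxE subr_eq0 eqr_nat eqSS.
  by rewrite gtn_eqF.
exists (l1norm (invmx V) ^+ 2 * (n * p)%:R).
  by rewrite mulr_ge0 ?exprn_ge0 ?l1norm_ge0.
move=> u M; pose U := \matrix_i u (i : 'I_n); pose P := V *m U.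
have SE : \sum_(i < n) l1norm (u i) = l1norm U.
  apply: eq_bigr => i _; rewrite /l1norm big_ord1.
  by apply: eq_bigr => j _; rewrite mxE.
have -> : M = \sum_l \sum_k `|P l k| ^+ 2.
  have rowP l : row l P = \sum_(i < n) (l.+1%:R ^+ i) *: u i.
    rewrite row_mul mulmx_sum_row; apply: eq_bigr => i _.
    by rewrite rowK !mxE.
  have adjP l : (row l P)^t* = \sum_(i < n) (l.+1%:R ^+ i) *: (u i)^t*.
    rewrite rowP linear_sum /= [LHS]raddf_sum; apply: eq_bigr => i _ /=.
    by apply/matrixP => a b; rewrite !mxE rmorphM /= conj_Creal ?rpredX ?realn.
  transitivity (\sum_l (row l P *m (row l P)^t*) 0 0); last first.
    by apply: eq_bigr => l _; rewrite row_sqnorm; apply: eq_bigr => k _; rewrite mxE.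
  under [RHS]eq_bigr => l _.
    rewrite adjP rowP mulmx_suml summxE.
    under eq_bigr => i _.
      rewrite mulmx_sumr summxE.
      under eq_bigr => j _.
        rewrite -scalemxAl -scalemxAr scalerA mxE -exprD.
        over.
      over.
    over.
  rewrite /M [RHS]exchange_big /=; apply: eq_bigr => i _.
  rewrite [RHS]exchange_big /=; apply: eq_bigr => j _.
  rewrite -mulr_suml natr_sum; congr (_ * _); apply: eq_bigr => l _.
  by rewrite natrX.
have UE : U = invmx V *m P by rewrite /P mulKmx.
split; first by do 2!apply: sumr_ge0 => ? _; rewrite exprn_ge0.
rewrite SE -mulrA.
apply: (@le_trans _ _ ((l1norm (invmx V) * l1norm P) ^+ 2)).
  rewrite ler_pXn2r ?nnegrE ?mulr_ge0 ?l1norm_ge0 // {1}UE; exact: l1normM.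
rewrite exprMn ler_wpM2l ?exprn_ge0 ?l1norm_ge0 //; exact: l1norm_sqr_le.
Qed.

(** In every one of the at most d^2 terms, either u_j is replaced by v_j, or
    one of the two indices is at least n: both cost a factor k. *)
Lemma hankel_perturbation n p d (u v : nat -> 'rV[C]_p) (S k : C) :
  (2 * n - 1 <= d)%N -> (0 < n)%N -> 0 <= k -> k <= 1 ->
  (forall i, (i < d)%N -> l1norm (u i) <= S) ->
  (forall i, (n <= i < d)%N -> l1norm (u i) <= k * S) ->
  (forall i, (i < d)%N -> l1norm (v i - u i) <= k * S) ->
  `|\sum_(i < d) \sum_(j < d - i) (moment n (i + j))%:R * (u i *m (v j)^t*) 0 0
   - \sum_(i < n) \sum_(j < n) (moment n (i + j))%:R * (u i *m (u j)^t*) 0 0|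
  <= (2 * (d * d) * \sum_(m < d) moment n m)%:R * k * S ^+ 2.
Proof.
move=> nd n0 k0 k1 uS ukS vu.
have le_nd : (n <= d)%N by lia.
have S0 : 0 <= S by apply: le_trans (uS 0%N _); rewrite ?l1norm_ge0 //; lia.
set cb := (\sum_(m < d) moment n m)%N.
pose H i j := (moment n (i + j))%:R * (u i *m (u j)^t*) 0 0.
(* The square i, j < n lies in the triangle i + j < d because 2n - 1 <= d. *)
have -> : \sum_(i < n) \sum_(j < n) (moment n (i + j))%:R * (u i *m (u j)^t*) 0 0
   = \sum_(i < d) \sum_(j < d - i) (if (i < n)%N && (j < n)%N then H i j else 0).
  rewrite (big_ord_widen d (fun i => \sum_(j < n) H i j)) // big_mkcond /=.
  apply: eq_bigr => i _; case: ltnP => [lt_in|_] /=; last by rewrite big1.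
  rewrite (big_ord_widen (d - i) (H i)); last by lia.
  by rewrite big_mkcond.
rewrite -sumrB; apply: le_trans (ler_norm_sum _ _ _) _.
have vS j : (j < d)%N -> l1norm (v j) <= 2 * S.
  move=> jd; rewrite -[v j](subrK (u j)); apply: le_trans (l1normD _ _) _.
  rewrite mulrDl mul1r; apply: lerD; last exact: uS.
  by apply: le_trans (vu _ jd) _; rewrite -[leRHS]mul1r ler_wpM2r.
have bnd i j : (i < d)%N -> (j < d - i)%N ->
    `|(moment n (i + j))%:R * (u i *m (v j)^t*) 0 0 -
      (if (i < n)%N && (j < n)%N then H i j else 0)| <= cb%:R * (2 * k * S ^+ 2).
  move=> id ji; have jd : (j < d)%N by lia.
  have -> : (moment n (i + j))%:R * (u i *m (v j)^t*) 0 0 -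
      (if (i < n)%N && (j < n)%N then H i j else 0) =
      (moment n (i + j))%:R * ((u i *m (v j)^t*) 0 0 -
      (if (i < n)%N && (j < n)%N then (u i *m (u j)^t*) 0 0 else 0)).
    by case: ifP => _; rewrite mulrBr ?mulr0.
  rewrite normrM normr_nat; apply: ler_pM => //.
    have ijd : (i + j < d)%N by lia.
    rewrite ler_nat /cb (bigD1 (Ordinal ijd)) //=; exact: leq_addr.
  have -> : 2 * k * S ^+ 2 = 2 * (k * S * S) by rewrite expr2; ring.
  have kSS : 0 <= k * S * S by rewrite !mulr_ge0.
  case: ifP => [/andP[lt_in lt_jn]|].
    have -> : (u i *m (v j)^t*) 0 0 - (u i *m (u j)^t*) 0 0 = (u i *m (v j - u j)^t*) 0 0.
      by rewrite linearB /= map_mxB mulmxBr !mxE.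
    apply: le_trans (inner_le _ _) _.
    apply: (@le_trans _ _ (k * S * S)).
      by rewrite mulrC; apply: ler_pM; rewrite ?l1norm_ge0 ?vu ?uS.
    by rewrite mulr_natl mulr2n lerDl.
  move/negbT; rewrite negb_and -!leqNgt subr0 => ij.
  apply: le_trans (inner_le _ _) _.
  case/orP: ij => [le_ni|le_nj].
    have -> : 2 * (k * S * S) = (k * S) * (2 * S) by ring.
    by apply: ler_pM; rewrite ?l1norm_ge0 ?vS ?ukS // le_ni.
  have -> : 2 * (k * S * S) = S * (2 * (k * S)) by ring.
  apply: ler_pM; rewrite ?l1norm_ge0 ?uS //.
  rewrite -[v j](subrK (u j)); apply: le_trans (l1normD _ _) _.
  by rewrite mulrDl mul1r; apply: lerD; rewrite ?vu ?ukS // le_nj.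
have -> : (2 * (d * d) * cb)%:R * k * S ^+ 2 =
    \sum_(i < d) \sum_(j < d) cb%:R * (2 * k * S ^+ 2).
  by rewrite !sumr_const !card_ord -mulrnA -[RHS]mulr_natl !natrM; ring.
have T0 : 0 <= cb%:R * (2 * k * S ^+ 2) by rewrite !mulr_ge0 ?exprn_ge0.
apply: ler_sum => i _; rewrite -sumrB; apply: le_trans (ler_norm_sum _ _ _) _.
apply: (@le_trans _ _ (\sum_(j < d - i) cb%:R * (2 * k * S ^+ 2))).
  by apply: ler_sum => j _; apply: bnd.
rewrite !sumr_const !card_ord; apply: ler_wpMn2l => //; exact: leq_subr.
Qed.

End Hankel.

(** * Local monotonicity of the moment polynomials *)

Section LocalMonotone.
Variable C : numClosedFieldType.

Lemma moment_poly_real n d : moment_poly C n d \is a polyOver Num.real.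
Proof.
apply/polyOverP => i; rewrite coefMX coef_poly.
by do 2?[case: ifP => _]; rewrite ?realn ?real0.
Qed.

Lemma horner_moment_poly n d N (x : 'M[C]_N.+1) :
  horner_mx x (moment_poly C n d) = \sum_(m < d) (moment n m)%:R *: x ^+ m.+1.
Proof.
rewrite /moment_poly rmorphM /= horner_mx_X poly_def rmorph_sum mulr_suml.
apply: eq_bigr => m _; rewrite /= linearZ /= rmorphXn /= horner_mx_X.
by rewrite -scalerAl exprSr.
Qed.

Lemma telescope_pow (R : nzRingType) (x y : R) m :
  y ^+ m - x ^+ m = \sum_(i < m) x ^+ i * (y - x) * y ^+ (m.-1 - i).
Proof.
elim: m => [|m IH]; first by rewrite big_ord0 subrr.
rewrite big_ord_recr /= subnn mulr1.
have -> : \sum_(i < m) x ^+ i * (y - x) * y ^+ (m - i) = (y ^+ m - x ^+ m) * y.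
  rewrite IH mulr_suml; apply: eq_bigr => i _; rewrite -[RHS]mulrA -exprSr.
  by congr (_ * y ^+ _); have := ltn_ord i; lia.
by rewrite mulrBl mulrBr -!exprSr addrA subrK.
Qed.

Lemma triangular_sum (G : nat -> nat -> C) d :
  \sum_(m < d) \sum_(i < m.+1) G i (m - i)%N = \sum_(i < d) \sum_(j < d - i) G i j.
Proof.
transitivity (\sum_(m < d) \sum_(i < d | (i <= m)%N) G i (m - i)%N).
  apply: eq_bigr => m _.
  by rewrite (big_ord_widen_cond d xpredT (fun i => G i (m - i)%N)).
rewrite (exchange_big_dep xpredT) //=; apply: eq_bigr => i _.
rewrite -(big_geq_mkord i d xpredT (fun m => G i (m - i)%N)).
rewrite -{1}[nat_of_ord i]add0n big_addn.
by rewrite big_mkord; apply: eq_bigr => j _; rewrite addnK.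
Qed.

(** The word x^i (y - x) y^j splits in the middle of y - x = b^* b. *)
Lemma moment_poly_form n d N (x y b : 'M[C]_N.+1) (w : 'rV[C]_N.+1) :
  y^t* = y -> y - x = b^t* *m b ->
  (w *m (horner_mx y (moment_poly C n d) - horner_mx x (moment_poly C n d))
     *m w^t*) 0 0
  = \sum_(i < d) \sum_(j < d - i) (moment n (i + j))%:R *
      ((w *m x ^+ i *m b^t*) *m (w *m y ^+ j *m b^t*)^t*) 0 0.
Proof.
move=> hy hE.
rewrite -(triangular_sum (fun i j => (moment n (i + j))%:R *
      ((w *m x ^+ i *m b^t*) *m (w *m y ^+ j *m b^t*)^t*) 0 0)).
rewrite !horner_moment_poly -sumrB mulmx_sumr mulmx_suml summxE.
apply: eq_bigr => m _; rewrite -scalerBr -scalemxAr -scalemxAl mxE.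
rewrite telescope_pow /= mulmx_sumr mulmx_suml summxE mulr_sumr.
apply: eq_bigr => i _; rewrite subnKC; last by rewrite -ltnS.
congr (_ * _).
rewrite hE !adjM trmxCK hermX //.
by rewrite -!mulmxE !mulmxA.
Qed.

(** The same telescoping as for the form, but expressing v_j - u_j through
    the vectors u_i with i < j only, so that they are controlled by the u_i
    alone. *)
Lemma vec_pow_diff N (x y b : 'M[C]_N.+1) (w : 'rV[C]_N.+1) j :
  y - x = b^t* *m b ->
  w *m y ^+ j *m b^t* - w *m x ^+ j *m b^t* =
  \sum_(i < j) (w *m x ^+ i *m b^t*) *m (b *m y ^+ (j.-1 - i) *m b^t*).
Proof.
move=> hE; rewrite -mulmxBl -mulmxBr telescope_pow mulmx_sumr mulmx_suml.
by apply: eq_bigr => i _; rewrite hE -!mulmxE !mulmxA.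
Qed.

(** The norms of x and y are at most K1 e, the small quantities in the form are
    at most K e times S, and K2 accounts for the number of terms and for their
    coefficients. The radius e makes the total perturbation at most the
    Hankel form M, and a real number at distance at most M from M is
    nonnegative. *)
Theorem moment_poly_local_monotone n d : (2 * n.+1 - 1 <= d)%N ->
  exists2 e : C, 0 < e & forall x y : 'M[C]_n.+1,
    x \is hermsymmx -> y \is hermsymmx -> spectrum_le x e -> spectrum_le y e ->
    (forall v : 'rV[C]_n.+1, 0 <= (v *m (y - x) *m v^t*) 0 0) ->
    forall w : 'rV[C]_n.+1,
      0 <= (w *m (horner_mx y (moment_poly C n.+1 d)
                  - horner_mx x (moment_poly C n.+1 d)) *m w^t*) 0 0.
Proof.
move=> nd; have [L L0 coercive] := hankel_coercive C n.+1 n.+1.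
pose K1 : nat := (n.+1 ^ 5)%N.
pose K : nat := (n.+1 * 2 ^ n.+1 + d * ((n.+1 * n.+1) * (2 * K1) * n.+1))%N.
pose K2 : nat := (2 * (d * d) * \sum_(m < d) moment n.+1 m)%N.
pose T : C := 1 + K1%:R + K%:R + K2%:R * K%:R * L.
have T1 : 1 <= T by rewrite /T -!addrA lerDl !addr_ge0 ?mulr_ge0.
have T0 : 0 < T := lt_le_trans ltr01 T1.
pose e := T^-1; exists e; first by rewrite invr_gt0.
have e0 : 0 <= e by rewrite invr_ge0 ltW.
have eT z : z <= T -> z * e <= 1.
  by move=> zT; rewrite ler_pdivrMr // mul1r.
have e1 : e <= 1 by rewrite -[e]mul1r; apply: eT.
have K1e : K1%:R * e <= 1.
  by apply: eT; rewrite /T addrAC [1 + _]addrC -!addrA lerDl !addr_ge0 ?mulr_ge0.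
have Ke1 : K%:R * e <= 1.
  by apply: eT; rewrite /T addrAC addrC lerDl !addr_ge0 ?mulr_ge0.
have K2e1 : K2%:R * K%:R * L * e <= 1.
  by apply: eT; rewrite /T [leRHS]addrC lerDl !addr_ge0.
have Ke0 : 0 <= K%:R * e by rewrite mulr_ge0.
move=> x y hx hy xe ye psd w.
have hxE := hx; rewrite hermsymmxE in hxE; move/eqP: hxE => hxE.
have hyE := hy; rewrite hermsymmxE in hyE; move/eqP: hyE => hyE.
have hh : y - x \is hermsymmx by rewrite hermsymmxE linearB /= map_mxB hxE hyE.
have [b hE bN] := psd_factor hh psd.
pose u i := w *m x ^+ i *m b^t*; pose v j := w *m y ^+ j *m b^t*.
have xN : l1norm x <= K1%:R * e by apply: spectrum_l1norm.
have yN : l1norm y <= K1%:R * e by apply: spectrum_l1norm.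
have bb : l1norm b ^+ 2 <= (n.+1 * n.+1)%:R * (2 * K1%:R * e).
  apply: le_trans bN _; rewrite ler_wpM2l //; apply: le_trans (l1normB _ _) _.
  by rewrite -mulrA mulrDl mul1r lerD.
have [a aN aE] := small_recurrence hx e0 e1 xe.
pose S := \sum_(k < n.+1) l1norm (u k).
have S0 : 0 <= S by apply: sumr_ge0 => i _; apply: l1norm_ge0.
have eta0 : 0 <= (2 ^ n.+1)%:R * e :> C by rewrite mulr_ge0.
have neta : n.+1%:R * ((2 ^ n.+1)%:R * e) <= K%:R * e.
  by rewrite mulrA -natrM ler_wpM2r // ler_nat leq_addr.
have usmall := recurrence_tail_le (a := fun i => l1norm (u i)) (n := n.+1)
   (fun i => l1norm_ge0 _) eta0 (le_trans neta Ke1).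
have {}usmall : forall i, l1norm (u i) <= S /\
    ((n.+1 <= i)%N -> l1norm (u i) <= K%:R * e * S).
  move=> i; have [i'|uS us] := usmall _ i; last first.
    by split=> // ni; apply: le_trans (us ni) _; rewrite ler_wpM2r.
  have -> : u (i' + n.+1)%N = \sum_k a k *: u (i' + k)%N.
    rewrite /u exprD aE mulr_sumr mulmx_sumr mulmx_suml; apply: eq_bigr => k _.
    by rewrite -scalerAr -scalemxAr -scalemxAl exprD.
  apply: le_trans (l1norm_sum _ _ _) _; apply: ler_sum => k _.
  by rewrite l1normZ ler_wpM2r ?l1norm_ge0.
have vu j : (j < d)%N -> l1norm (v j - u j) <= K%:R * e * S.
  move=> jd; rewrite /v /u vec_pow_diff //.
  apply: le_trans (l1norm_sum _ _ _) _.
  pose B : C := ((n.+1 * n.+1) * (2 * K1) * n.+1)%:R * e.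
  have B0 : 0 <= B by rewrite mulr_ge0.
  apply: (@le_trans _ _ (\sum_(i < j) S * B)).
    apply: ler_sum => i _; apply: le_trans (l1normM _ _) _.
    apply: ler_pM; rewrite ?l1norm_ge0 //; first by have [] := usmall i.
    apply: le_trans (l1normM _ _) _; rewrite l1norm_adj.
    apply: (@le_trans _ _ (l1norm b * l1norm (y ^+ (j.-1 - i)) * l1norm b)).
      by rewrite ler_wpM2r ?l1norm_ge0 ?l1normM.
    rewrite mulrAC -expr2; have -> : B = (n.+1 * n.+1)%:R * (2 * K1%:R * e) * n.+1%:R.
      by rewrite /B !natrM; ring.
    apply: ler_pM; rewrite ?exprn_ge0 ?l1norm_ge0 //.
    by apply: mxpow_l1norm; apply: le_trans yN _.
  rewrite sumr_const card_ord -[leLHS]mulr_natl mulrCA [leRHS]mulrC ler_wpM2l //.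
  apply: (@le_trans _ _ (d%:R * B)).
    by rewrite ler_wpM2r // ler_nat ltnW.
  by rewrite /B mulrA -natrM ler_wpM2r // ler_nat leq_addl.
pose M := \sum_(i < n.+1) \sum_(j < n.+1)
   (moment n.+1 (i + j))%:R * (u i *m (u j)^t*) 0 0.
have [M0 MS] : 0 <= M /\ S ^+ 2 <= L * M := coercive u.
set F := _ - horner_mx x _.
have Freal : (w *m F *m w^t*) 0 0 \is Num.real.
  have FE : F^t* = F.
    by rewrite linearB /= map_mxB !horner_herm ?moment_poly_real.
  have /matrixP/(_ 0 0) : (w *m F *m w^t*)^t* = w *m F *m w^t*.
    by rewrite !adjM trmxCK FE mulmxA.
  by rewrite CrealE [LHS]mxE [X in X^*]mxE => ->.
move: Freal; rewrite (moment_poly_form _ _ _ hyE hE).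
set Q := \sum_(i < d) _ => Qreal.
have QM : `|Q - M| <= M.
  apply: le_trans (hankel_perturbation nd (ltn0Sn n) Ke0 Ke1
    (fun i _ => (usmall i).1) _ vu) _.
    by move=> i /andP[ni _]; apply: (usmall i).2.
  rewrite -/K2.
  apply: (@le_trans _ _ (K2%:R * (K%:R * e) * (L * M))).
    by rewrite ler_wpM2l // mulr_ge0.
  have -> : K2%:R * (K%:R * e) * (L * M) = K2%:R * K%:R * L * e * M by ring.
  by rewrite -[leRHS]mul1r ler_wpM2r.
have QMreal : Q - M \is Num.real by rewrite rpredB // ger0_real.
by move: QM; rewrite real_ler_norml // => /andP[+ _]; rewrite lerBrDr addNr.
Qed.

End LocalMonotone.

(** * Walks on a path with a loop at one end *)

Section Walk.
Variables (R : nzRingType) (n : nat).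

Definition path_mx : 'M[R]_n.+1 :=
  \matrix_(i, j) ((i.+1 == j) || (j.+1 == i))%:R.

Definition lollipop_mx : 'M[R]_n.+1 := path_mx + delta_mx ord0 ord0.

(** Vertex j is at distance j from 0, and the shortest walk is unique. *)
Lemma lollipop_walk m (j : 'I_n.+1) :
  (m <= j)%N -> (lollipop_mx ^+ m) ord0 j = (m == j)%:R.
Proof.
elim: m j => [|m IH] j mj; first by rewrite expr0 mxE.
have mn : (m < n.+1)%N by apply: ltn_trans mj _.
rewrite exprSr mxE (bigD1 (Ordinal mn)) //= IH // eqxx mul1r big1 ?addr0.
  rewrite !mxE /= [j.+1 == m]gtn_eqF ?orbF; last by rewrite ltnS ltnW.
  have /negPf-> : j != ord0 by rewrite -val_eqE /= -lt0n; apply: leq_trans mj.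
  by rewrite andbF addr0.
move=> k; rewrite -val_eqE /= => km.
have [mk|km'] := leqP m k; first by rewrite IH // eq_sym (negPf km) mul0r.
rewrite !mxE.
have -> : (k.+1 == j) || (j.+1 == k) = false by lia.
have /negPf-> : j != ord0 by rewrite -val_eqE /= -lt0n; apply: leq_trans mj.
by rewrite andbF addr0 mulr0.
Qed.

(** A walk from i to j through the loop has length at least i + 1 + j. The
    induction splits off the first step: either it is the loop, or it follows an
    edge of the path and the rest of the walk still has to use the loop. *)
Lemma loop_walk m (i j : 'I_n.+1) : (m <= (i + j).+1)%N ->
  (lollipop_mx ^+ m - path_mx ^+ m) i j = (m == (i + j).+1)%:R.
Proof.
elim: m i => [|m IH] i; first by rewrite !expr0 subrr mxE.
rewrite ltnS => mij.
have -> : lollipop_mx ^+ m.+1 - path_mx ^+ m.+1 =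
    path_mx *m (lollipop_mx ^+ m - path_mx ^+ m) + delta_mx ord0 ord0 *m lollipop_mx ^+ m.
  by rewrite !exprS {1}/lollipop_mx mulrDl mulmxBr addrAC.
have loopE (A : 'M[R]_n.+1) : (delta_mx ord0 ord0 *m A) i j = (i == ord0)%:R * A ord0 j.
  rewrite mxE (bigD1 ord0) //= big1 => [|k /negPf k0].
    by rewrite addr0 mxE eqxx andbT.
  by rewrite mxE k0 andbF mul0r.
rewrite mxE loopE mxE eqSS.
(* After a step away from the loop, too few steps are left. *)
have up (k : 'I_n.+1) : (k.+1 == i) = false ->
    path_mx i k * (lollipop_mx ^+ m - path_mx ^+ m) k j = 0.
  move=> ki; rewrite mxE ki orbF; case: eqP => [ik|_]; last by rewrite mul0r.
  by rewrite IH; [rewrite (_ : m == _ = false) ?mulr0 //; lia|lia].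
have [i0|i0] := eqVneq i ord0.
  rewrite mul1r big1 ?add0r ?lollipop_walk ?i0 //; first by rewrite i0 in mij.
  by move=> k _; rewrite -i0 up // i0.
have ipn : (i.-1 < n.+1)%N by apply: leq_ltn_trans (leq_pred _) _.
have ip : (0 < i)%N by rewrite lt0n.
rewrite mul0r addr0 (bigD1 (Ordinal ipn)) //= big1 ?addr0.
  rewrite IH /=; last by rewrite -addSn prednK.
  by rewrite mxE /= prednK // eqxx orbT mul1r -addSn prednK.
move=> k; rewrite -val_eqE /= => ki; apply: up; lia.
Qed.

End Walk.

Lemma horner_loop_walk (R : comNzRingType) n (q : {poly R}) (i j : 'I_n.+1) :
  (size q <= (i + j).+2)%N ->
  (horner_mx (lollipop_mx R n) q - horner_mx (path_mx R n) q) i j = q`_(i + j).+1.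
Proof.
move=> sq.
have hE (A : 'M[R]_n.+1) : horner_mx A q = \sum_(m < (i + j).+2) q`_m *: A ^+ m.
  rewrite -{1}(coefK q) poly_def rmorph_sum.
  rewrite (big_ord_widen _ (fun m => horner_mx A (q`_m *: 'X^m)) sq).
  rewrite big_mkcond; apply: eq_bigr => m _ /=; case: ltnP => [_|qm].
    by rewrite linearZ /= rmorphXn /= horner_mx_X.
  by rewrite nth_default // scale0r.
rewrite !hE -sumrB summxE big_ord_recr /= -scalerBr mxE loop_walk //.
rewrite eqxx mulr1 big1 ?add0r // => m _.
by rewrite -scalerBr mxE loop_walk ?ltn_eqF ?mulr0 //; exact: ltnW.
Qed.

(** * Real polynomials of complex Hermitian matrices *)

Lemma horner_mx_comp (R : comNzRingType) n (x : 'M[R]_n.+1) p q :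
  horner_mx x (p \Po q) = horner_mx (horner_mx x q) p.
Proof.
elim/poly_ind: p => [|p c IH]; first by rewrite comp_poly0 !rmorph0.
rewrite comp_polyD comp_polyM comp_polyX comp_polyC.
by rewrite !rmorphD !rmorphM /= IH !horner_mx_C horner_mx_X.
Qed.

Section RealPolynomials.
Variable R : realType.
Notation toC := (map_poly (real_complex R)).

Lemma normc_real (r : R) : `|r%:C| = `|r|%:C.
Proof. by rewrite normc_def /= expr0n addr0 sqrtr_sqr. Qed.

Lemma toC_real (p : {poly R}) : toC p \is a polyOver Num.real.
Proof.
by apply/polyOverP => i; rewrite coef_map /= complex_real.
Qed.

Lemma toC_moment_poly n d : toC (moment_poly R n d) = moment_poly R[i] n d.
Proof.
apply/polyP => k; rewrite coef_map !coefMX !coef_poly.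
by case: (k == 0%N); case: (k.-1 < d)%N; rewrite /= ?rmorph_nat ?rmorph0.
Qed.

Lemma mxfun_poly n (x : 'M[R[i]]_n.+1) (p : {poly R}) : x \is hermsymmx ->
  mxfun (fun t => p.[t]) x = horner_mx x (toC p).
Proof.
move=> hx; rewrite (horner_mx_spectral _ hx) /mxfun.
rewrite (invmx_unitary (spectral_unitarymx x)).
suff -> : map_mx (fun z => (p.[complex.Re z])%:C) (spectral_diag x)
  = map_mx (horner (toC p)) (spectral_diag x) by [].
apply/rowP => i; rewrite !mxE.
have /mxOverP/(_ 0 i) := hermitian_spectral_diag_real hx.
by move=> /RRe_real {2}<-; rewrite horner_map.
Qed.

Lemma loewner_le_mxfun n (x y : 'M[R[i]]_n.+1) (p : {poly R}) :
  x \is hermsymmx -> y \is hermsymmx ->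
  loewner_le (mxfun (fun t => p.[t]) x) (mxfun (fun t => p.[t]) y) <->
  forall v : 'rV[R[i]]_n.+1,
    0 <= (v *m (horner_mx y (toC p) - horner_mx x (toC p)) *m v^t*) 0 0.
Proof.
move=> hx hy; rewrite /loewner_le (mxfun_poly _ hx) (mxfun_poly _ hy).
split=> [[_ psd]|psd]; [exact: psd|split; last exact: psd].
move: hx hy; rewrite !hermsymmxE => /eqP hx /eqP hy.
by rewrite linearB /= map_mxB !horner_herm ?toC_real.
Qed.

Lemma affine_hermsym n (s t : R) (x : 'M[R[i]]_n) : x \is hermsymmx ->
  s%:C *: x + t%:C%:M \is hermsymmx.
Proof.
rewrite !hermsymmxE => /eqP hx; apply/eqP/matrixP => i j.
have /matrixP/(_ i j) := hx; rewrite !mxE => xij.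
by rewrite rmorphD rmorphM rmorphMn /= xij !conj_Creal ?complex_real // eq_sym.
Qed.

(** Moves the choice of a point and of a scale in I from the matrices to the
    polynomial. *)
Lemma horner_mx_affine n (A : 'M[R[i]]_n.+1) (p : {poly R}) (s t : R) :
  horner_mx (s%:C *: A + t%:C%:M) (toC p)
  = horner_mx A (toC (p \Po (s *: 'X + t%:P))).
Proof.
rewrite map_comp_poly horner_mx_comp rmorphD /= map_polyZ map_polyX map_polyC.
by rewrite rmorphD /= linearZ /= horner_mx_X horner_mx_C.
Qed.

Lemma affine_poly_size (s t : R) : s != 0 -> size (s *: 'X + t%:P) = 2.
Proof.
move=> s0; rewrite size_polyDl ?size_scale ?size_polyX //.
exact: leq_ltn_trans (size_polyC_leq1 _) _.
Qed.

(** * No polynomial of low degree *)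

Lemma interval_has_ball (I : set R) : nontrivial_interval I ->
  exists t d : R, 0 < d /\ forall u, `|u - t| <= d -> I u.
Proof.
move=> [itvI [a [b [Ia Ib ab]]]].
wlog {ab} ab : a b Ia Ib / a < b => [hw|].
  by case: (ltgtP a b) ab => // [ab|ba] _; [apply: (hw a b)|apply: (hw b a)].
exists ((a + b) / 2), ((b - a) / 2); split=> [|u]; first by lra.
rewrite ler_norml => /andP[u1 u2].
by apply: (itvI a b Ia Ib); apply/andP; split; lra.
Qed.

Lemma spectrum_in_affine (I : set R) (t d s : R) n (A : 'M[R[i]]_n) :
  (forall u, `|u - t| <= d -> I u) -> 0 <= s -> A \is hermsymmx ->
  s%:C * l1norm A <= d%:C -> spectrum_in I (s%:C *: A + t%:C%:M).
Proof.
move=> Id s0 hA sA z zx.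
have hx : (s%:C *: A + t%:C%:M)^t* = s%:C *: A + t%:C%:M.
  by apply/eqP; rewrite -hermsymmxE affine_hermsym.
have /RRe_real zE := hermitian_eigenvalue_real hx zx.
exists (complex.Re z); last by rewrite zE.
apply: Id; rewrite -lecR; apply: le_trans sA.
have /eigenvalueP[v vx v0] := zx.
have vA : eigenvalue (s%:C *: A) (z - t%:C).
  apply/eigenvalueP; exists v => //; rewrite scalerBl -vx mulmxDr mul_mx_scalar.
  by rewrite addrK.
have := eigenvalue_le_l1norm vA; rewrite l1normZ normc_real (ger0_norm s0).
by rewrite -{1}zE -rmorphB normc_real.
Qed.

Lemma path_mx_herm n : path_mx R[i] n \is hermsymmx.
Proof.
rewrite hermsymmxE; apply/eqP/matrixP => k l.
by rewrite !mxE orbC rmorph_nat.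
Qed.

Lemma delta_mx_herm n (k : 'I_n) : (delta_mx k k : 'M[R[i]]_n) \is hermsymmx.
Proof.
rewrite hermsymmxE; apply/eqP/matrixP => a b.
by rewrite !mxE andbC rmorph_nat.
Qed.

(** The pair of matrices is t + s A and t + s (A + E), with A the path and E
    the loop, where t is the centre of a ball inside I and s is small enough for
    both spectra to lie in that ball. *)
Theorem low_degree_not_matrix_monotone (I : set R) n (p : {poly R}) :
  nontrivial_interval I -> (1 < degree p < 2 * n.+1 - 1)%N ->
  ~ matrix_monotone n.+1 I (fun t => p.[t]).
Proof.
move=> /interval_has_ball[t [d [d0 Id]]] deg_p [_ mono].
(* k is half the degree, rounded up: the least vertex whose diagonal entry is
   forced to vanish; the vertex j then exists because the degree is at least 2. *)
have [k [j [kn jn dk jk]]] : exists k j : nat,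
    [/\ (k < n.+1)%N, (j < n.+1)%N, (degree p <= k + k)%N & (j + k).+1 = degree p].
  exists (uphalf (degree p)), (degree p - uphalf (degree p) - 1)%N.
  by split; lia.
have size_p : (size p <= (degree p).+1)%N := leqSpred _.
pose A := path_mx R[i] n; pose B := lollipop_mx R[i] n.
have hA : A \is hermsymmx := path_mx_herm n.
have hB : B \is hermsymmx.
  move: hA (delta_mx_herm (ord0 : 'I_n.+1)); rewrite !hermsymmxE => /eqP hA /eqP hE.
  by rewrite linearD /= map_mxD hA hE.
have normR m (M : 'M[R[i]]_m) : (complex.Re (l1norm M))%:C = l1norm M.
  by apply/RRe_real/ger0_real/l1norm_ge0.
pose r := 1 + complex.Re (l1norm A) + complex.Re (l1norm B).
have reA : 0 <= complex.Re (l1norm A) by rewrite -lecR normR l1norm_ge0.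
have reB : 0 <= complex.Re (l1norm B) by rewrite -lecR normR l1norm_ge0.
have r0 : 0 < r by rewrite /r; lra.
pose s := d / r.
have s0 : 0 < s by rewrite divr_gt0.
have sr : s * r = d by rewrite divfK // gt_eqF.
have small (M : 'M[R[i]]_n.+1) : complex.Re (l1norm M) <= r -> s%:C * l1norm M <= d%:C.
  by move=> Mr; rewrite -normR -rmorphM lecR -sr ler_wpM2l // ltW.
have rA : complex.Re (l1norm A) <= r by rewrite /r; lra.
have rB : complex.Re (l1norm B) <= r by rewrite /r; lra.
have spA := spectrum_in_affine Id (ltW s0) hA (small _ rA).
have spB := spectrum_in_affine Id (ltW s0) hB (small _ rB).
have {}mono := mono _ _ (affine_hermsym s t hA) (affine_hermsym s t hB) spA spB.
have le_AB : loewner_le (s%:C *: A + t%:C%:M) (s%:C *: B + t%:C%:M).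
  have BA : s%:C *: B + t%:C%:M - (s%:C *: A + t%:C%:M) = s%:C *: delta_mx ord0 ord0.
    by rewrite opprD addrACA subrr addr0 -scalerBr /B /lollipop_mx addrAC subrr add0r.
  rewrite /loewner_le BA; split.
    have := affine_hermsym s 0 (delta_mx_herm (ord0 : 'I_n.+1)).
    by rewrite raddf0 addr0.
  move=> v; rewrite -scalemxAr -scalemxAl mxE mulr_ge0 //; first by rewrite lecR ltW.
  have -> : (v *m delta_mx ord0 ord0 *m v^t*) 0 0 = `|v 0 ord0| ^+ 2.
    rewrite mxE (bigD1 ord0) //= big1 => [|a a0].
      rewrite addr0 normCK !mxE (bigD1 ord0) //= big1 => [|a a0].
        by rewrite !mxE !eqxx mulr1 addr0.
      by rewrite !mxE (negPf a0) mulr0.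
    rewrite [X in X * _]mxE big1 ?mul0r // => l _.
    by rewrite mxE (negPf a0) andbF mulr0.
  by rewrite exprn_ge0.
have {le_AB} := mono le_AB.
rewrite (loewner_le_mxfun _ (affine_hermsym s t hA) (affine_hermsym s t hB)).
rewrite !horner_mx_affine; set q := p \Po _.
have sq : size q = size p by rewrite size_comp_poly2 // affine_poly_size // gt_eqF.
set F := _ - _ => psd.
have FE : F^t* = F.
  move: hA hB; rewrite !hermsymmxE => /eqP hA /eqP hB.
  by rewrite linearB /= map_mxB !horner_herm ?toC_real.
have entry (a b : 'I_n.+1) : (degree p <= (a + b).+1)%N -> F a b = (q`_(a + b).+1)%:C.
  move=> dab; rewrite /F horner_loop_walk ?coef_map //.
  by rewrite size_map_poly sq (leq_trans size_p).
have Fkk : F (Ordinal kn) (Ordinal kn) = 0.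
  rewrite entry /=; last exact: leqW.
  by rewrite nth_default // sq (leq_trans size_p).
have := psd_zero_diag (Ordinal jn) FE psd Fkk.
rewrite entry /= jk // => /eqP; rewrite fmorph_eq0 /degree -sq -lead_coefE.
rewrite lead_coef_eq0 -size_poly_eq0 sq.
by case/andP: deg_p; rewrite /degree; case: (size p).
Qed.

(** * Polynomials of every high degree *)

Lemma moment_gt0 n m : (0 < moment n.+1 m)%N.
Proof. by rewrite /moment big_ord_recl exp1n. Qed.

Lemma size_moment_poly n d : (0 < d)%N -> size (moment_poly R n.+1 d) = d.+1.
Proof.
case: d => // d _; rewrite /moment_poly.
have c0 : (moment n.+1 d)%:R != 0 :> R by rewrite pnatr_eq0 -lt0n moment_gt0.
have sp : size (\poly_(m < d.+1) ((moment n.+1 m)%:R : R)) = d.+1.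
  by rewrite size_poly_eq.
by rewrite size_mulX ?sp // -size_poly_gt0 sp.
Qed.

Lemma bounded_set_ball (I : set R) : bounded_set I ->
  exists2 M : R, 0 < M & forall u, I u -> `|u| <= M.
Proof.
move=> [M [_ IM]]; exists (`|M| + 1); first by have := normr_ge0 M; lra.
by apply: IM; have := ler_norm M; lra.
Qed.

Lemma spectrum_in_scale (I : set R) n (x : 'M[R[i]]_n) (s r M : R) :
  (forall u, I u -> `|u| <= M) -> 0 < s -> s * M <= r -> spectrum_in I x ->
  spectrum_le (s%:C *: x + 0%:C%:M) r%:C.
Proof.
move=> IM s0 sM xI z /eigenvalueP[v vx v0].
have sC0 : s%:C != 0 by rewrite fmorph_eq0 gt_eqF.
have /xI[u Iu zE] : eigenvalue x (z / s%:C).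
  apply/eigenvalueP; exists v => //.
  rewrite mulrC -scalerA -vx raddf0 addr0 -scalemxAr scalerA.
  by rewrite mulVf // scale1r.
rewrite -[z](divfK sC0) zE -rmorphM normc_real lecR normrM (gtr0_norm s0) mulrC.
by apply: le_trans sM; rewrite ler_wpM2l ?IM // ltW.
Qed.

Theorem matrix_monotone_of_degree (I : set R) n d : bounded_set I ->
  (2 * n.+1 - 1 <= d)%N ->
  exists p : {poly R}, degree p = d /\ matrix_monotone n.+1 I (fun t => p.[t]).
Proof.
move=> /bounded_set_ball[M M0 IM] nd.
have [e e0 mono] := moment_poly_local_monotone R[i] nd.
pose r := complex.Re e.
have rE : r%:C = e by apply/RRe_real/gtr0_real.
have r0 : 0 < r by rewrite -ltcR rE.
pose s := r / M.
have s0 : 0 < s by rewrite divr_gt0.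
have sM : s * M <= r by rewrite divfK // gt_eqF.
exists (moment_poly R n.+1 d \Po (s *: 'X + 0%:P)); split.
  rewrite /degree size_comp_poly2 ?affine_poly_size ?gt_eqF //.
  by rewrite size_moment_poly //; lia.
split; first exact/continuous_subspaceT/continuous_horner.
move=> x y hx hy xI yI [_ psd].
rewrite (loewner_le_mxfun _ hx hy) -!horner_mx_affine !toC_moment_poly.
apply: mono; try exact: affine_hermsym.
- by rewrite -rE; apply: spectrum_in_scale IM s0 sM xI.
- by rewrite -rE; apply: spectrum_in_scale IM s0 sM yI.
move=> v; rewrite opprD addrACA subrr addr0 -scalerBr -scalemxAr -scalemxAl mxE.
by rewrite mulr_ge0 ?psd // lecR ltW.
Qed.

End RealPolynomials.

(** * The theorem *)

(* In the third clause the guard (1 < degree p) only discards affine functions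
   for n = 1: these lie in every class, so the clause would be false for them. *)
Theorem theorem2p2 (R : realType) (I : set R) (n : nat)
    (hI : nontrivial_interval I) (hbnd : bounded_set I) (hn : (0 < n)%N) :
  (forall p : {poly R}, (1 < degree p < 2 * n - 1)%N ->
     ~ matrix_monotone n I (fun t => p.[t])) /\
  (forall d : nat, (2 * n - 1 <= d)%N ->
     exists p : {poly R}, degree p = d /\ matrix_monotone n I (fun t => p.[t])) /\
  (forall p : {poly R}, (1 < degree p)%N ->
     (degree p = 2 * n - 1 \/ degree p = 2 * n)%N ->
     matrix_monotone n I (fun t => p.[t]) ->
     matrix_monotone n I (fun t => p.[t]) /\
     ~ matrix_monotone n.+1 I (fun t => p.[t])).
Proof.
case: n hn => // n _; split; [|split].
- by move=> p; apply: low_degree_not_matrix_monotone.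
- by move=> d; apply: matrix_monotone_of_degree.
move=> p p1 deg_p mono; split=> //.
by apply: low_degree_not_matrix_monotone => //; rewrite p1 /=; case: deg_p => ->; lia.
Qed.
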